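(* Let $N\ge1$, $\omega\in C^+_{\mathrm{inc}}$, and let $(\rho_\varepsilon)_{\varepsilon>0}\subset L^1(\mathbb{R}^N)$ be a family of radial mollifiers of the form $\rho_\varepsilon(h)=\varepsilon^{-N}\rho(h/\varepsilon)$ for some $\rho\in L^1(\mathbb{R}^N)$. Then for $f\in L^\infty(\mathbb{R}^N)$ the following are equivalent: (i) $f\in C^{0,1}(\mathbb{R}^N)$; (ii) $\displaystyle\limsup_{\varepsilon\downarrow0}\int_{\mathbb{R}^N}\rho_\varepsilon(h)\,\omega\!\left(\frac{\|f(\cdot+h)-f\|_{L^\infty(\mathbb{R}^N)}}{|h|}\right)\mathrm{d}h<\infty$. Moreover, there are constants $0<c\le C$ independent of $f$ such that \[c\,\omega\big([f]_{C^{0,1}(\mathbb{R}^N)}\big)\le\limsup_{\varepsilon\downarrow0}\int_{\mathbb{R}^N}\rho_\varepsilon(h)\,\omega\!\left(\frac{\|f(\cdot+h)-f\|_{L^\infty(\mathbb{R}^N)}}{|h|}\right)\mathrm{d}h\le C\,\omega\big([f]_{C^{0,1}(\mathbb{R}^N)}\big).\]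
   Context: Mollifiers: $\rho_\varepsilon\ge0$, $\int\rho_\varepsilon=1$, and $\lim_{\varepsilon\downarrow0}\int_{|z|\ge\delta}\rho_\varepsilon=0$ for all $\delta>0$. $C^{0,1}(\mathbb{R}^N)$ is the set of $f\in L^\infty(\mathbb{R}^N)$ with $[f]_{C^{0,1}}:=\sup_{h\ne0}|h|^{-1}\|f(\cdot+h)-f\|_{L^\infty}<\infty$. $C^+_{\mathrm{inc}}$ is the set of continuous increasing $\omega:[0,\infty)\to[0,\infty)$ with $\omega(0)=0$, $\lim_{t\to\infty}\omega(t)=\infty$, and roughly subadditive: there is $A>0$ with $\omega(t_1+t_2)\le A(\omega(t_1)+\omega(t_2))$ for all $t_1,t_2\ge0$. Convention $\omega(+\infty)=+\infty$. *)

(* Defs.v *)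
From HB Require Import structures.
From mathcomp Require Import all_boot all_order all_algebra.
From mathcomp Require Import all_classical all_reals all_analysis.
Set Implicit Arguments. Unset Strict Implicit. Unset Printing Implicit Defensive.
Import Order.TTheory GRing.Theory Num.Theory.
Import numFieldNormedType.Exports.
Local Open Scope classical_set_scope.
Local Open Scope ring_scope.

Section RN.
Variable R : realType.

Definition vadd (n : nat) (x y : n.-tuple R) : n.-tuple R :=
  [tuple tnth x i + tnth y i | i < n].
Definition vscale (n : nat) (a : R) (x : n.-tuple R) : n.-tuple R :=
  [tuple a * tnth x i | i < n].
Definition enorm (n : nat) (x : n.-tuple R) : R :=
  Num.sqrt (\sum_(i < n) tnth x i ^+ 2).

(* Lebesgue integral on R^N of an (extended-real) function, as the iterated
   integral w.r.t. one-dimensional Lebesgue measure (by Tonelli this is the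
   Lebesgue integral on R^N for nonnegative measurable integrands, which is
   the only case used below). *)
Fixpoint intRN (n : nat) : (n.-tuple R -> \bar R) -> \bar R :=
  match n return (n.-tuple R -> \bar R) -> \bar R with
  | 0 => fun g => g [tuple]
  | n'.+1 => fun g =>
      (\int[@lebesgue_measure R]_x intRN (fun t : n'.-tuple R => g [tuple of x :: t]))%E
  end.

Definition negligibleRN (n : nat) (A : set (n.-tuple R)) : Prop :=
  exists B : set (n.-tuple R), [/\ measurable B, A `<=` B &
     intRN (fun x => (\1_B x)%:E) = 0%E].

Definition Linf_norm (n : nat) (g : n.-tuple R -> R) : \bar R :=
  ereal_inf [set y : \bar R | negligibleRN [set x | (y < (`|g x|)%:E)%E]].

Definition in_Linf (n : nat) (f : n.-tuple R -> R) : Prop :=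
  measurable_fun [set: n.-tuple R] f /\ (Linf_norm f < +oo)%E.

Definition diff_quot (n : nat) (f : n.-tuple R -> R) (h : n.-tuple R) : \bar R :=
  (Linf_norm (fun x => (f (vadd x h) - f x)%R) * ((enorm h)^-1)%:E)%E.

Definition lip_seminorm (n : nat) (f : n.-tuple R -> R) : \bar R :=
  ereal_sup [set diff_quot f h | h in [set h | h != [tuple of nseq n 0]]].

Definition in_C01 (n : nat) (f : n.-tuple R -> R) : Prop :=
  in_Linf f /\ (lip_seminorm f < +oo)%E.

Definition C_inc_plus (w : R -> R) : Prop :=
  [/\ {within [set t : R | 0 <= t], continuous w},
      (forall t, 0 <= t -> 0 <= w t),
      (forall s t, 0 <= s -> s <= t -> w s <= w t) /\ w 0 = 0,
      (w x @[x --> +oo] --> +oo) &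
      exists2 A : R, 0 < A & forall t1 t2, 0 <= t1 -> 0 <= t2 ->
        w (t1 + t2) <= A * (w t1 + w t2)].

Definition omegaE (w : R -> R) (x : \bar R) : \bar R :=
  match x with
  | EFin r => (w r)%:E
  | +oo%E => +oo%E
  | -oo%E => -oo%E (* never used: arguments are nonnegative *)
  end.

Definition rho_eps (n : nat) (rho : n.-tuple R -> R) (eps : R) (h : n.-tuple R) : R :=
  eps ^- n * rho (vscale eps^-1 h).

Definition mollifier_family (n : nat) (rhoe : R -> n.-tuple R -> R) : Prop :=
  [/\ forall eps, 0 < eps -> forall h, 0 <= rhoe eps h,
      forall eps, 0 < eps -> intRN (fun h => (rhoe eps h)%:E) = 1%E &
      forall delta, 0 < delta ->
        ((fun eps => intRN (fun z => ((rhoe eps z) * (\1_[set z | delta <= enorm z] z))%:E))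
          @ 0^'+ --> 0%E)].

Definition in_L1 (n : nat) (rho : n.-tuple R -> R) : Prop :=
  measurable_fun [set: n.-tuple R] rho /\
  (intRN (fun h => (`|rho h|)%:E) < +oo)%E.

Definition radial (n : nat) (rho : n.-tuple R -> R) : Prop :=
  forall x y, enorm x = enorm y -> rho x = rho y.

Definition mod_limsup (n : nat) (w : R -> R) (rho : n.-tuple R -> R)
    (f : n.-tuple R -> R) : \bar R :=
  limf_esup (fun eps : R =>
      intRN (fun h => ((rho_eps rho eps h)%:E * omegaE w (diff_quot f h))%E))
    0^'+.

End RN.

(* Main.v *)
Require Import Defs.
From HB Require Import structures.
From mathcomp Require Import all_boot all_order all_algebra.
From mathcomp Require Import all_classical all_reals all_analysis.
From mathcomp Require Import measurable_realfun ring.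
Import Order.TTheory GRing.Theory Num.Theory.
Import numFieldNormedType.Exports.
Local Open Scope classical_set_scope.
Local Open Scope ring_scope.
Set Implicit Arguments. Unset Strict Implicit. Unset Printing Implicit Defensive.

(** Let D(h) = ||f(. + h) - f||_oo and q(h) = D(h) / |h|. D is even, subadditive
    and, by Fubini, measurable. The upper bound with C = 1 is immediate since
    q <= [f]. For the lower bound, choose a bounded set E of positive finite
    measure m on which rho is bounded below. By regularity of the Lebesgue
    measure on lines and Fatou's lemma there is s > 0 such that E and its
    translate by s e_i overlap in measure at least m / 2, for every i. As
    s e_i = (h + s e_i) - h, integrating over the overlap bounds
    omega (D (eps s e_i) / (eps r)) by the functional at eps, up to a constant.
    Finally D(h) <= k D(h / k) <= k sum_i D(h_i e_i / k), and for k large each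
    h_i / k is plus or minus eps s with eps arbitrarily small. *)

(** * The iterated integral on R^n: monotonicity, linearity, Fatou, Tonelli *)

Section intRN_theory.
Variable R : realType.
Local Open Scope ereal_scope.
Local Notation mu := (@lebesgue_measure R).
Implicit Types n : nat.

Lemma intRN_ge0 n (g : n.-tuple R -> \bar R) :
  (forall x, 0 <= g x) -> 0 <= intRN g.
Proof.
by elim: n g => [|n IH] g g0 //=; apply: integral_ge0 => x _; exact: IH.
Qed.

(** The parameter space is arbitrary so that the induction can absorb the first coordinate into it,
    passing from [X] to [X * R]; Tonelli's theorem then gives measurability of the outermost
    integral. *)
Lemma measurable_intRN_param n d (X : measurableType d)
    (g : X * n.-tuple R -> \bar R) : measurable_fun setT g ->
  (forall z, 0 <= g z) ->
  measurable_fun setT (fun x => intRN (fun t => g (x, t))).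
Proof.
elim: n d X g => [|n IH] d X g mg g0 /=.
  by apply: (measurableT_comp mg); exact: measurable_pair2.
pose G (p : X * R) := intRN (fun t : n.-tuple R => g (p.1, [tuple of p.2 :: t])).
have mG : measurable_fun setT G.
  apply: (IH _ (X * R)%type (fun q => g (q.1.1, [tuple of q.1.2 :: q.2]))) => //.
  apply: (measurableT_comp mg); apply: measurable_fun_pair.
    exact: measurableT_comp.
  by apply: measurable_cons => //; exact: measurableT_comp.
apply: (@measurable_fun_fubini_tonelli_F _ _ _ _ _ mu G mG).
by move=> p; apply: intRN_ge0.
Qed.

Lemma measurable_tuple_cons n :
  measurable_fun setT (fun p : R * n.-tuple R => [tuple of p.1 :: p.2]).
Proof. by apply: measurable_cons. Qed.

Lemma measurable_section n (g : n.+1.-tuple R -> \bar R) (x : R) :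
  measurable_fun setT g ->
  measurable_fun setT (fun t : n.-tuple R => g [tuple of x :: t]).
Proof.
by move=> mg; apply: (measurableT_comp mg); apply: measurable_cons.
Qed.

Lemma measurable_intRN_tail n (g : n.+1.-tuple R -> \bar R) :
  measurable_fun setT g -> (forall x, 0 <= g x) ->
  measurable_fun setT (fun x => intRN (fun t : n.-tuple R => g [tuple of x :: t])).
Proof.
move=> mg g0.
apply: (@measurable_intRN_param _ _ _ (fun p => g [tuple of p.1 :: p.2])) => //.
apply: (measurableT_comp mg); exact: measurable_tuple_cons.
Qed.

Lemma le_intRN n (g1 g2 : n.-tuple R -> \bar R) :
  measurable_fun setT g1 -> measurable_fun setT g2 ->
  (forall x, 0 <= g1 x) -> (forall x, g1 x <= g2 x) -> intRN g1 <= intRN g2.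
Proof.
elim: n g1 g2 => [|n IH] g1 g2 m1 m2 p1 le12 //=.
have p2 x : 0 <= g2 x by exact: le_trans (p1 x) (le12 x).
apply: ge0_le_integral => //.
- by move=> x _; exact: intRN_ge0.
- exact: measurable_intRN_tail.
- exact: measurable_intRN_tail.
- by move=> x _; apply: IH => //; exact: measurable_section.
Qed.

Lemma intRND n (g1 g2 : n.-tuple R -> \bar R) :
  measurable_fun setT g1 -> measurable_fun setT g2 ->
  (forall x, 0 <= g1 x) -> (forall x, 0 <= g2 x) ->
  intRN (fun x => g1 x + g2 x) = intRN g1 + intRN g2.
Proof.
elim: n g1 g2 => [|n IH] g1 g2 m1 m2 p1 p2 //=.
rewrite -ge0_integralD//.
- by apply: eq_integral => x _; rewrite IH//; exact: measurable_section.
- by move=> x _; exact: intRN_ge0.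
- exact: measurable_intRN_tail.
- by move=> x _; exact: intRN_ge0.
- exact: measurable_intRN_tail.
Qed.

Lemma intRNZl n (g : n.-tuple R -> \bar R) (k : \bar R) :
  measurable_fun setT g -> (forall x, 0 <= g x) -> 0 <= k ->
  intRN (fun x => k * g x) = k * intRN g.
Proof.
elim: n g => [|n IH] g mg g0 k0 //=.
rewrite -ge0_integralZl//.
- by apply: eq_integral => x _; rewrite IH//; exact: measurable_section.
- exact: measurable_intRN_tail.
- by move=> x _; exact: intRN_ge0.
Qed.

Lemma le_limn_einf (u : (\bar R)^nat) (a : \bar R) :
  (\forall k \near \oo, a <= u k) -> a <= limn_einf u.
Proof.
move=> [K _ aK]; rewrite limn_einf_lim.
apply: lime_ge; first exact: is_cvg_einfs.
exists K => // m /= Km; apply: le_ereal_inf_tmp => _ [k /= mk <-].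
by apply: aK => /=; exact: leq_trans mk.
Qed.

Lemma lt_limn_einf (u : (\bar R)^nat) (a : \bar R) :
  a < limn_einf u -> \forall k \near \oo, a < u k.
Proof.
rewrite limn_einf_lim (cvg_lim _ (@cvg_einfs_sup R u))// => /ereal_sup_gt.
move=> [_ [m _ <-] am]; exists m => // k /= mk.
by apply: lt_le_trans am _; apply: ereal_inf_lbound; exists k.
Qed.

Lemma measurable_limn_einf d (X : measurableType d) (f : (X -> \bar R)^nat) :
  (forall k, measurable_fun setT (f k)) ->
  measurable_fun setT (fun x => limn_einf (f ^~ x)).
Proof.
move=> mf.
rewrite (_ : (fun x => _) = (fun x => - limn_esup (fun k => - f k x))).
  apply: measurableT_comp => //; apply: measurable_fun_limn_esup => k.
  exact: measurableT_comp.
by apply/funext => x; rewrite limn_esupN oppeK.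
Qed.

(** By induction on the dimension: the induction hypothesis bounds the inner integrals pointwise,
    and Fatou's lemma on the line handles the outer one. *)
Lemma intRN_fatou n (g : nat -> n.-tuple R -> \bar R) :
  (forall k, measurable_fun setT (g k)) -> (forall k x, 0 <= g k x) ->
  intRN (fun x => limn_einf (g ^~ x)) <= limn_einf (fun k => intRN (g k)).
Proof.
elim: n g => [|n IH] g mg g0 //=.
have lim0 x : 0 <= limn_einf (g ^~ x).
  by apply: le_limn_einf; near=> k; exact: g0.
have mlim : measurable_fun setT (fun x => limn_einf (g ^~ x)).
  exact: measurable_limn_einf.
apply: le_trans (fatou _ _ _ _) => //.
- apply: ge0_le_integral => //.
  + by move=> x _; exact: intRN_ge0.
  + exact: (measurable_intRN_tail mlim).
  + by apply: measurable_limn_einf => k; exact: measurable_intRN_tail.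
  + by move=> x _; apply: IH => // k; exact: measurable_section.
- by move=> k; exact: measurable_intRN_tail.
- by move=> k x _; exact: intRN_ge0.
Unshelve. all: by end_near. Qed.

(** Tonelli's theorem in the plane moves the extra variable past one coordinate at a time. This
    allows the first coordinate of a tuple to be integrated innermost. *)
Lemma intRN_swap n (g : R * n.-tuple R -> \bar R) :
  measurable_fun setT g -> (forall z, 0 <= g z) ->
  \int[mu]_x intRN (fun t => g (x, t)) =
  intRN (fun t => \int[mu]_x g (x, t)).
Proof.
elim: n g => [|n IH] g mg g0 //=.
have mg' : measurable_fun setT
    (fun q : (R * R) * n.-tuple R => g (q.1.1, [tuple of q.1.2 :: q.2])).
  apply: (measurableT_comp mg); apply: measurable_fun_pair.
    exact: measurableT_comp.
  by apply: measurable_cons => //; exact: measurableT_comp.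
transitivity (\int[mu]_y \int[mu]_x
    intRN (fun t : n.-tuple R => g (x, [tuple of y :: t]))).
  apply: (@fubini_tonelli _ _ _ _ R mu mu (fun p : R * R =>
    intRN (fun t : n.-tuple R => g (p.1, [tuple of p.2 :: t])))).
    exact: (measurable_intRN_param mg').
  by move=> p; exact: intRN_ge0.
apply: eq_integral => y _.
rewrite (IH (fun p => g (p.1, [tuple of y :: p.2])))//.
apply: (measurableT_comp mg); apply: measurable_fun_pair => //.
exact: measurable_cons.
Qed.

(** The image of Lebesgue measure under x -> a x + b, multiplied by [a], agrees with Lebesgue
    measure on half-open intervals, so the two coincide by uniqueness. *)
Lemma ge0_integral_affine (f : R -> \bar R) (a b : R) : (0 < a)%R ->
  measurable_fun setT f -> (forall x, 0 <= f x) ->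
  \int[mu]_x f (a * x + b)%R = (a^-1)%:E * \int[mu]_x f x.
Proof.
move=> a0 mf f0.
pose phi : R -> R := fun x => (a * x + b)%R.
have mphi : @measurable_fun _ _ (measurableTypeR R) (measurableTypeR R) setT phi.
  by apply: measurable_funD.
have a0' : (0 <= a)%R by exact: ltW.
pose m : {measure set (measurableTypeR R) -> \bar R}
  := mscale (NngNum a0')
    (measure_function_pushforward__canonical__measure_function_Measure mu mphi).
have muE : forall A : set R, measurable A -> mu A = m A.
  apply: (@lebesgue_measure_unique R m) => X [[c d] _ <-] /=.
  transitivity (a%:E * mu [set` `]((c - b) / a)%R, ((d - b) / a)%R]]); last first.
    congr (_ * mu _); apply/seteqP; split => x /=; rewrite !in_itv/= /phi;
      by rewrite ltr_pdivrMr// ler_pdivlMr// ltrBlDr lerBrDr (mulrC x).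
  rewrite !lebesgue_measure_itv/= !lte_fin ltr_pM2r ?invr_gt0// ltrD2r.
  case: ifPn => _; last by rewrite mule0.
  rewrite -!EFinB -EFinM; congr EFin.
  by rewrite -mulrBl mulrCA divff ?gt_eqF// mulr1 opprB addrA addrNK.
rewrite [in RHS](@eq_measure_integral _ _ _ setT m); last by move=> A mA _; exact: muE.
rewrite ge0_integral_mscale//= ge0_integral_pushforward//.
by rewrite muleA -EFinM mulVf ?gt_eqF// mul1e.
Qed.

End intRN_theory.

(** * Vector operations on tuples and the Euclidean norm *)

Section tuple_vectors.
Variable R : realType.
Implicit Types n : nat.
Local Open Scope ring_scope.

Lemma tnth_vadd n (x y : n.-tuple R) i : tnth (vadd x y) i = tnth x i + tnth y i.
Proof. by rewrite tnth_mktuple. Qed.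

Lemma tnth_vscale n (a : R) (x : n.-tuple R) i : tnth (vscale a x) i = a * tnth x i.
Proof. by rewrite tnth_mktuple. Qed.

Lemma vaddA n (x y z : n.-tuple R) : vadd x (vadd y z) = vadd (vadd x y) z.
Proof. by apply: eq_from_tnth => i; rewrite !tnth_vadd addrA. Qed.

Lemma vaddC n (x y : n.-tuple R) : vadd x y = vadd y x.
Proof. by apply: eq_from_tnth => i; rewrite !tnth_vadd addrC. Qed.

Lemma vadd0 n (x : n.-tuple R) : vadd x [tuple of nseq n 0] = x.
Proof. by apply: eq_from_tnth => i; rewrite tnth_vadd tnth_nseq addr0. Qed.

Lemma vaddNr n (x : n.-tuple R) : vadd x (vscale (-1) x) = [tuple of nseq n 0].
Proof.
by apply: eq_from_tnth => i; rewrite tnth_vadd tnth_vscale tnth_nseq mulN1r subrr.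
Qed.

Lemma vscaleDr n (a : R) (x y : n.-tuple R) :
  vscale a (vadd x y) = vadd (vscale a x) (vscale a y).
Proof.
by apply: eq_from_tnth => i; rewrite !(tnth_vadd, tnth_vscale) mulrDr.
Qed.

Lemma vscaleDl n (a b : R) (x : n.-tuple R) :
  vscale (a + b) x = vadd (vscale a x) (vscale b x).
Proof.
by apply: eq_from_tnth => i; rewrite !(tnth_vadd, tnth_vscale) mulrDl.
Qed.

Lemma vscaleA n (a b : R) (x : n.-tuple R) :
  vscale a (vscale b x) = vscale (a * b) x.
Proof. by apply: eq_from_tnth => i; rewrite !tnth_vscale mulrA. Qed.

Lemma vscale1 n (x : n.-tuple R) : vscale 1 x = x.
Proof. by apply: eq_from_tnth => i; rewrite tnth_vscale mul1r. Qed.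

Lemma vscale0 n (x : n.-tuple R) : vscale 0 x = [tuple of nseq n 0].
Proof. by apply: eq_from_tnth => i; rewrite tnth_vscale tnth_nseq mul0r. Qed.

Lemma vadd_cons n (a b : R) (x y : n.-tuple R) :
  vadd [tuple of a :: x] [tuple of b :: y] = [tuple of a + b :: vadd x y].
Proof.
apply: eq_from_tnth => i; case: (unliftP ord0 i) => [j|] ->.
  by rewrite !(tnth_vadd, tnthS).
by rewrite !(tnth_vadd, tnth0).
Qed.

Lemma vscale_cons n (a b : R) (x : n.-tuple R) :
  vscale a [tuple of b :: x] = [tuple of a * b :: vscale a x].
Proof.
apply: eq_from_tnth => i; case: (unliftP ord0 i) => [j|] ->.
  by rewrite !(tnth_vscale, tnthS).
by rewrite !(tnth_vscale, tnth0).
Qed.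

Lemma measurable_vadd n d (X : measurableType d) (f g : X -> n.-tuple R) :
  measurable_fun setT f -> measurable_fun setT g ->
  measurable_fun setT (fun x => vadd (f x) (g x)).
Proof.
move=> mf mg; apply/measurable_fun_tnthP => i.
rewrite (_ : _ \o _ = fun x => tnth (f x) i + tnth (g x) i); last first.
  by apply/funext => x /=; rewrite tnth_vadd.
by apply: measurable_funD; [move/measurable_fun_tnthP : mf => /(_ i)|
  move/measurable_fun_tnthP : mg => /(_ i)].
Qed.

Lemma measurable_vscale n d (X : measurableType d) (a : R) (f : X -> n.-tuple R) :
  measurable_fun setT f -> measurable_fun setT (fun x => vscale a (f x)).
Proof.
move=> mf; apply/measurable_fun_tnthP => i.
rewrite (_ : _ \o _ = fun x => a * tnth (f x) i); last first.
  by apply/funext => x /=; rewrite tnth_vscale.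
by apply: measurable_funM => //; move/measurable_fun_tnthP : mf => /(_ i).
Qed.

Lemma measurable_enorm n : measurable_fun setT (@enorm R n).
Proof.
rewrite /enorm; apply: measurableT_comp => //.
  exact: continuous_measurable_fun (@sqrt_continuous R).
apply: measurable_sum => i.
by apply: measurable_funX; exact: measurable_tnth.
Qed.

Lemma enorm_ge0 n (x : n.-tuple R) : 0 <= enorm x.
Proof. exact: sqrtr_ge0. Qed.

Lemma enorm_vscale n (a : R) (x : n.-tuple R) : enorm (vscale a x) = `|a| * enorm x.
Proof.
rewrite /enorm -sqrtr_sqr -sqrtrM ?sqr_ge0// mulr_sumr; congr Num.sqrt.
by apply: eq_bigr => i _; rewrite tnth_vscale exprMn.
Qed.

Lemma enorm0 n : enorm [tuple of nseq n (0 : R)] = 0.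
Proof. by rewrite -(vscale0 [tuple of nseq n 0]) enorm_vscale normr0 mul0r. Qed.

Lemma le_tnth_enorm n (x : n.-tuple R) i : `|tnth x i| <= enorm x.
Proof.
rewrite -sqrtr_sqr ler_wsqrtr// (bigD1 i)//= lerDl.
by apply: sumr_ge0 => j _; exact: sqr_ge0.
Qed.

Lemma enorm_gt0 n (x : n.-tuple R) : (0 < enorm x) = (x != [tuple of nseq n 0]).
Proof.
rewrite lt_neqAle enorm_ge0 andbT eq_sym; congr negb.
apply/eqP/eqP => [x0|->]; last exact: enorm0.
apply: eq_from_tnth => i; rewrite tnth_nseq.
by apply/eqP; rewrite -normr_le0 -x0 le_tnth_enorm.
Qed.

End tuple_vectors.

(** * Affine changes of variables, indicator functions and constants *)

Section intRN_change_of_variables.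
Variable R : realType.
Local Open Scope ereal_scope.
Local Notation mu := (@lebesgue_measure R).
Implicit Types n : nat.

(** Each coordinate contributes one factor a^-1: the induction hypothesis treats the tail at a fixed
    first coordinate, and the substitution on the line treats that coordinate. *)
Lemma intRN_affine n (g : n.-tuple R -> \bar R) (a : R) (b : n.-tuple R) :
  (0 < a)%R -> measurable_fun setT g -> (forall x, 0 <= g x) ->
  intRN (fun x => g (vadd (vscale a x) b)) = (a ^- n)%:E * intRN g.
Proof.
move=> a0; elim: n g b => [|n IH] g b mg g0 /=.
  by rewrite expr0 invr1 mul1e; congr g; apply: eq_from_tnth => -[].
case/tupleP: b => y b.
have -> : (fun x => intRN (fun t : n.-tuple R =>
    g (vadd (vscale a [tuple of x :: t]) [tuple of y :: b]))) =
  (fun x => (a ^- n)%:E * intRN (fun t : n.-tuple R => g [tuple of (a * x + y)%R :: t])).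
  apply/funext => x.
  rewrite -(IH (fun t => g [tuple of (a * x + y)%R :: t]) b)//; last exact: measurable_section.
  by congr intRN; apply/funext => t; rewrite vscale_cons vadd_cons.
pose G x := intRN (fun t : n.-tuple R => g [tuple of x :: t]).
have mG : measurable_fun setT G by exact: measurable_intRN_tail.
have G0 x : 0 <= G x by exact: intRN_ge0.
have ma : measurable_fun setT (fun x : R => (a * x + y)%R) by apply: measurable_funD.
rewrite ge0_integralZl//.
- by rewrite (ge0_integral_affine y a0 mG)// muleA -EFinM exprSr invfM mulrC.
- exact: (measurableT_comp mG ma).
- by move=> x _; exact: intRN_ge0.
- by rewrite lee_fin invr_ge0 exprn_ge0// ltW.
Qed.

Lemma intRN_shift n (g : n.-tuple R -> \bar R) (b : n.-tuple R) :
  measurable_fun setT g -> (forall x, 0 <= g x) ->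
  intRN (fun x => g (vadd x b)) = intRN g.
Proof.
move=> mg g0; rewrite -[RHS]mul1e -[in RHS](invr1 R) -[in RHS](expr1n R n).
rewrite -(intRN_affine b ltr01 mg g0).
by congr intRN; apply/funext => x; rewrite vscale1.
Qed.

Lemma measurable_indicE d (X : measurableType d) (A : set X) :
  measurable A -> measurable_fun setT (fun x => (\1_A x : R)%:E).
Proof. by move=> mA; apply/measurable_EFinP; exact: measurable_indic. Qed.

Lemma indicE_ge0 (X : Type) (A : set X) x : 0 <= (\1_A x : R)%:E.
Proof. by rewrite lee_fin indicE. Qed.

Lemma le_indicE (X : Type) (A B : set X) x : A `<=` B ->
  (\1_A x : R)%:E <= (\1_B x)%:E.
Proof.
move=> AB; rewrite lee_fin !indicE ler_nat.
have [/set_mem/AB xB|_] := boolP (x \in A); first by rewrite mem_set.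
by [].
Qed.

Lemma intRN_cst0 n : @intRN R n (fun=> 0) = 0.
Proof.
elim: n => [|n IH] //=.
by rewrite -[RHS](@integral0 _ _ R mu setT); apply: eq_integral => x _; exact: IH.
Qed.

Lemma intRN_cst1 n : 0 < @intRN R n (fun=> 1).
Proof.
elim: n => [|n IH] /=; first exact: lte01.
rewrite integral_cst// mule_gt0//.
have := @lebesgue_measure_itv R `]-oo, +oo[; rewrite set_itvNyy/= => ->.
by rewrite ltey.

Qed.

End intRN_change_of_variables.

(** * Null sets: subsets, unions, translates *)

Section negligible_sets.
Variable R : realType.
Local Open Scope ereal_scope.
Implicit Types n : nat.

Lemma negligibleRN_sub n (A B : set (n.-tuple R)) :
  A `<=` B -> negligibleRN B -> negligibleRN A.
Proof. by move=> AB [C [mC BC C0]]; exists C; split => //; exact: subset_trans BC. Qed.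

Lemma negligibleRN0 n : negligibleRN (@set0 (n.-tuple R)).
Proof.
exists set0; split => //; rewrite -[RHS](intRN_cst0 R n).
by congr intRN; apply/funext => x; rewrite indic0.
Qed.

Lemma negligibleRNU n (A B : set (n.-tuple R)) :
  negligibleRN A -> negligibleRN B -> negligibleRN (A `|` B).
Proof.
move=> [A' [mA AA' A0]] [B' [mB BB' B0]]; exists (A' `|` B'); split.
- exact: measurableU.
- exact: setUSS.
- apply/eqP; rewrite eq_le intRN_ge0 ?andbT; last by move=> x; exact: indicE_ge0.
  have -> : 0 = intRN (fun x => (\1_A' x : R)%:E + (\1_B' x : R)%:E) :> \bar R.
    rewrite intRND ?A0 ?B0 ?adde0//; try exact: measurable_indicE;
      by move=> x; exact: indicE_ge0.
  apply: le_intRN.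
  + by apply: measurable_indicE; exact: measurableU.
  + by apply: emeasurable_funD; exact: measurable_indicE.
  + by move=> x; exact: indicE_ge0.
  + move=> x; rewrite -EFinD lee_fin !indicE in_setU -natrD ler_nat.
    by case: (x \in A'); case: (x \in B').
Qed.

Lemma negligibleRN_shift n (A : set (n.-tuple R)) h :
  negligibleRN A -> negligibleRN [set x | A (vadd x h)].
Proof.
move=> [B [mB AB B0]]; exists [set x | B (vadd x h)]; split.
- rewrite -[X in measurable X]setTI.
  exact: (measurable_vadd (g := cst h)).
- by move=> x /AB.
- rewrite -[RHS]B0 -(intRN_shift h (measurable_indicE mB)); last first.
    by move=> x; exact: indicE_ge0.
  by congr intRN; apply/funext => x; rewrite !indicE.
Qed.

Lemma measurable_negligibleRNP n (A : set (n.-tuple R)) : measurable A ->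
  negligibleRN A <-> intRN (fun x => (\1_A x : R)%:E) = 0.
Proof.
move=> mA; split=> [[B [mB AB B0]]|A0]; last by exists A; split.
apply/eqP; rewrite eq_le [X in _ && X]intRN_ge0; last by move=> x; exact: indicE_ge0.
rewrite andbT -B0; apply: le_intRN; try exact: measurable_indicE.
  by move=> x; exact: indicE_ge0.
by move=> x; exact: le_indicE.
Qed.

Lemma negligibleRNT n : ~ negligibleRN [set: n.-tuple R].
Proof.
move=> /(measurable_negligibleRNP measurableT) T0.
suff E : (fun x : n.-tuple R => (\1_[set: n.-tuple R] x : R)%:E) = fun=> 1.
  by have := intRN_cst1 R n; rewrite -E T0 ltxx.
by apply/funext => x; rewrite indicT.
Qed.

End negligible_sets.

(** * The translation modulus of a measurable function *)

Section translation_modulus.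
Variables (R : realType) (n : nat) (f : n.-tuple R -> R).
Local Open Scope ereal_scope.
Implicit Types (g : n.-tuple R -> R) (h k : n.-tuple R).

(** The infimum ranges over all extended reals, but a negative level would make the exceptional set
    the whole space, which is not negligible. *)
Lemma Linf_norm_ge0 g : 0 <= Linf_norm g.
Proof.
apply: le_ereal_inf_tmp => y /= yg; rewrite leNgt; apply/negP => y0.
apply: (@negligibleRNT R n); apply: negligibleRN_sub yg => x _ /=.
by rewrite (lt_le_trans y0)// lee_fin.
Qed.

(** The function D of the overview, isolated from [diff_quot] because it is even and subadditive. *)
Definition modulus h := Linf_norm (fun x => f (vadd x h) - f x)%R.

Lemma modulus_ge0 h : 0 <= modulus h.
Proof. exact: Linf_norm_ge0. Qed.

Lemma modulus_negligible h (y : \bar R) : modulus h < y ->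
  negligibleRN [set x | y < (`|f (vadd x h) - f x|%R)%:E].
Proof.
move=> /ereal_inf_lt[z /= zf zy]; apply: negligibleRN_sub zf => x /=.
exact: lt_trans.
Qed.

Lemma modulus_le h (y : \bar R) :
  negligibleRN [set x | y < (`|f (vadd x h) - f x|%R)%:E] -> modulus h <= y.
Proof. by move=> yf; apply: ereal_inf_lbound. Qed.

Lemma modulus0 : modulus [tuple of nseq n 0%R] = 0.
Proof.
apply/eqP; rewrite eq_le modulus_ge0 andbT; apply: modulus_le.
rewrite (_ : [set x | _] = set0); first exact: negligibleRN0.
by apply/seteqP; split => x //=; rewrite vadd0 subrr normr0 ltxx.
Qed.

(** The increment by h + k at x is the increment by h at x + k plus the increment by k at x, and
    null sets are stable under shifts and unions. The margin [e] is split in two so that levels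
    strictly above both infima can be used. *)
Lemma modulus_add h k : modulus (vadd h k) <= modulus h + modulus k.
Proof.
have [->|hy] := eqVneq (modulus h) +oo.
  by rewrite addye ?leey// gt_eqF// (lt_le_trans _ (modulus_ge0 k)).
have [->|ky] := eqVneq (modulus k) +oo.
  by rewrite addey ?leey// gt_eqF// (lt_le_trans _ (modulus_ge0 h)).
have hf : modulus h \is a fin_num by rewrite ge0_fin_numE ?modulus_ge0// ltey.
have kf : modulus k \is a fin_num by rewrite ge0_fin_numE ?modulus_ge0// ltey.
apply/lee_addgt0Pr => e e0; rewrite -(fineK hf) -(fineK kf).
have e20 : (0 < e / 2)%R by rewrite divr_gt0.
have Nh := @modulus_negligible h (fine (modulus h) + e / 2)%:E.
have Nk := @modulus_negligible k (fine (modulus k) + e / 2)%:E.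
apply: modulus_le.
apply: (negligibleRN_sub _ (negligibleRNU (negligibleRN_shift k (Nh _)) (Nk _))).
- move=> x /=; rewrite -!EFinD !lte_fin => lt; apply: contrapT.
  move=> /not_orP[/negP + /negP]; rewrite -!leNgt => le1 le2.
  move: lt; rewrite ltNge => /negP; apply.
  rewrite (vaddC h) vaddA.
  have -> : (f (vadd (vadd x k) h) - f x =
    (f (vadd (vadd x k) h) - f (vadd x k)) + (f (vadd x k) - f x))%R.
    by rewrite addrA subrK.
  apply: (le_trans (ler_normD _ _)); apply: (le_trans (lerD le1 le2)).
  by rewrite addrACA -splitr.
- by rewrite EFinD fineK// lteDl// lte_fin.
- by rewrite EFinD fineK// lteDl// lte_fin.
Qed.

(** Up to sign, the increment by -h at x is the increment by h at x - h, so the exceptional sets are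
    translates of each other. *)
Lemma modulus_opp_le h : modulus (vscale (-1) h) <= modulus h.
Proof.
apply: le_ereal_inf_tmp => y /= yg; apply: modulus_le.
apply: negligibleRN_sub (negligibleRN_shift (vscale (-1) h) yg) => x /=.
by rewrite -vaddA (vaddC _ h) vaddNr vadd0 distrC.
Qed.

Lemma modulus_opp h : modulus (vscale (-1) h) = modulus h.
Proof.
apply/eqP; rewrite eq_le modulus_opp_le/=.
have := modulus_opp_le (vscale (-1) h).
by rewrite vscaleA mulrNN mulr1 vscale1.
Qed.

Lemma modulus_natmul (k : nat) h :
  modulus (vscale k%:R h) <= k%:R%:E * modulus h.
Proof.
elim: k => [|k IH]; first by rewrite vscale0 modulus0 mul0e.
rewrite -addn1 natrD vscaleDl (le_trans (modulus_add _ _))// vscale1.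
by rewrite EFinD ge0_muleDl ?lee_fin// mul1e leeD2r.
Qed.

Lemma modulus_sum (m : nat) (v : 'I_m -> n.-tuple R) :
  modulus [tuple (\sum_(j < m) tnth (v j) i)%R | i < n] <= \sum_(j < m) modulus (v j).
Proof.
elim: m v => [|m IH] v.
  rewrite big_ord0 (_ : [tuple _ | _ < _] = [tuple of nseq n 0%R]) ?modulus0//.
  by apply: eq_from_tnth => i; rewrite tnth_mktuple tnth_nseq big_ord0.
rewrite big_ord_recl; apply: le_trans (leeD2l _ (IH _)).
apply: le_trans (modulus_add _ _).
rewrite le_eqVlt; apply/orP; left; apply/eqP; congr modulus.
apply: eq_from_tnth => i; rewrite tnth_vadd !tnth_mktuple big_ord_recl.
by [].
Qed.

(** The set where D < r is the union over rationals q < r of the sets where [I q h], the measure of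
    the x with |f(x + h) - f(x)| > q, vanishes; this measure depends measurably on h by Tonelli. *)
Lemma measurable_modulus : measurable_fun setT f -> measurable_fun setT modulus.
Proof.
move=> mf.
apply: (measurability _ (ErealGenInftyO.measurableE R)) => _ [_ [r ->] <-].
rewrite setTI.
pose S (q : R) : set (n.-tuple R * n.-tuple R) :=
  [set p | (q < `|f (vadd p.2 p.1) - f p.2|)%R].
pose I (q : R) h := intRN (fun x => (\1_(S q) (h, x) : R)%:E).
have mS q : measurable (S q).
  rewrite -[X in measurable X]setTI.
  pose F (p : n.-tuple R * n.-tuple R) := (f (vadd p.2 p.1) - f p.2)%R.
  have mF : measurable_fun setT F.
    apply: measurable_funB.
      exact: (measurableT_comp mf (measurable_vadd measurable_snd measurable_fst)).
    exact: (measurableT_comp mf measurable_snd).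
  have mG : measurable_fun setT (fun p => `|F p|%R) by exact: measurableT_comp.
  rewrite (_ : S q = (fun p => `|F p|%R) @^-1` `]q, +oo[%classic); first exact: mG.
  by apply/seteqP; split => p /=; rewrite in_itv/= andbT.
have mI q : measurable_fun setT (I q).
  apply: (@measurable_intRN_param R n _ (n.-tuple R) (fun p => (\1_(S q) p : R)%:E)).
    by apply: measurable_indicE; exact: mS.
  by move=> p; exact: indicE_ge0.
have IE q h : I q h = 0 <->
    negligibleRN [set x | q%:E < (`|f (vadd x h) - f x|%R)%:E].
  have -> : [set x | q%:E < (`|f (vadd x h) - f x|%R)%:E] = xsection (S q) h.
    by apply/seteqP; split => x; rewrite /xsection/= inE/= lte_fin.
  rewrite measurable_negligibleRNP; last exact: measurable_xsection.
  suff -> : I q h = intRN (fun x => (\1_(xsection (S q) h) x : R)%:E) by [].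
  by congr intRN; apply/funext => x; rewrite !indicE mem_xsection.
rewrite (_ : _ @^-1` _ = \bigcup_(q : rat)
    (if (ratr q < r)%R then I (ratr q) @^-1` [set 0] else set0)).
  apply: countable_bigcupT_measurable; first exact: countableP.
  move=> q; case: ifPn => _ //.
  by rewrite -[X in measurable X]setTI; apply: mI => //; exact: emeasurable_set1.
apply/seteqP; split => h /=.
  rewrite in_itv/= => /ereal_inf_lt[z /= zf zr].
  have [q zq qr] : exists2 q : rat, z <= (ratr q)%:E & (ratr q < r)%R.
    case: z zr {zf} => [z zr|//|_].
      have [q +] := rat_in_itvoo zr; rewrite in_itv/= => /andP[zq qr].
      by exists q => //; rewrite lee_fin ltW.
    (* In the remaining case z = -oo, any rational between r - 1 and r serves. *)
    have r1 : (r - 1 < r)%R by rewrite ltrBlDr ltrDl.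
    have [q +] := rat_in_itvoo r1; rewrite in_itv/= => /andP[zq qr].
    by exists q => //; rewrite leNye.
  exists q => //=; rewrite qr/=; apply/IE; apply: negligibleRN_sub zf => x /=.
  exact: le_lt_trans.
move=> [q _]; case: ifPn => [qr /IE qf|//]; rewrite in_itv/=.
by rewrite (le_lt_trans (modulus_le qf))// lte_fin.
Qed.

End translation_modulus.

(** * Roughly subadditive increasing functions *)

Section omega.
Variables (R : realType) (w : R -> R).
Hypothesis Hw : C_inc_plus w.
Local Open Scope ereal_scope.
Implicit Types x y : \bar R.

Lemma omegaE_le x y : 0 <= x -> x <= y -> omegaE w x <= omegaE w y.
Proof.
case: Hw => _ _ [wle _] _ _; case: x y => [r| |] [s| |]//=.
- by rewrite !lee_fin; exact: wle.
- by move=> _ _; rewrite leey.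
all: by rewrite ?leye_eq ?leeNy_eq.
Qed.

Lemma omegaE0 : omegaE w 0 = 0.
Proof. by case: Hw => _ _ [_ w0] _ _ /=; rewrite w0. Qed.

Lemma omegaE_ge0 x : 0 <= x -> 0 <= omegaE w x.
Proof. by move=> x0; rewrite -omegaE0; exact: omegaE_le. Qed.

Lemma omegaE_add : exists2 A : R, (0 < A)%R & forall x y, 0 <= x -> 0 <= y ->
  omegaE w (x + y) <= A%:E * (omegaE w x + omegaE w y).
Proof.
case: Hw => _ w0 _ _ [A A0 wA]; exists A => // x y x0 y0.
move: x y x0 y0 => [r| |] [s| |]//= r0 s0.
- by rewrite -EFinD -EFinM lee_fin; apply: wA; rewrite -lee_fin.
- by rewrite addey// gt0_muley// lte_fin.
- by rewrite addye// gt0_muley// lte_fin.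
- by rewrite addye// gt0_muley// lte_fin.
Qed.

(** For integer factors this iterates rough subadditivity; a general [a] lies below an integer and
    omega is increasing. The constant depends on [a] and [w] only. *)
Lemma omegaE_scale (a : R) : (0 <= a)%R -> exists2 K : R, (0 < K)%R & forall x, 0 <= x ->
  omegaE w (a%:E * x) <= K%:E * omegaE w x.
Proof.
move=> a0; have [A A0 wA] := omegaE_add.
have nat_scale (n : nat) : exists2 K : R, (0 < K)%R & forall x, 0 <= x ->
    omegaE w (n%:R%:E * x) <= K%:E * omegaE w x.
  elim: n => [|n [K K0 IH]].
    by exists 1%R => // x x0; rewrite mul0e omegaE0 mul1e omegaE_ge0.
  exists (A * (K + 1))%R => [|x x0]; first by rewrite mulr_gt0// addr_gt0.
  rewrite -addn1 natrD EFinD ge0_muleDl ?lee_fin// mul1e.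
  apply: (le_trans (wA _ _ _ _)) => //; first by rewrite mule_ge0// lee_fin.
  rewrite EFinM -muleA lee_pmul2l ?lte_fin//.
  rewrite EFinD ge0_muleDl ?lee_fin ?(ltW K0)// mul1e.
  by rewrite leeD2r// IH.
have [K K0 wK] := nat_scale (Num.bound a).
exists K => // x x0; apply: le_trans (wK x x0).
apply: omegaE_le; first by rewrite mule_ge0// lee_fin.
by rewrite lee_wpmul2r// lee_fin ltW// archi_boundP.
Qed.

(** Some element of [S] exceeds half of a finite positive supremum, and the factor 2 is absorbed by
    [omegaE_scale]. If the supremum is infinite, the divergence of [w] at infinity forces B =
    +oo. *)
Lemma omegaE_sup : exists2 K : R, (0 < K)%R &
  forall (S : set \bar R) (B : \bar R), S !=set0 ->
    (forall y, S y -> 0 <= y) -> (forall y, S y -> omegaE w y <= B) ->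
    omegaE w (ereal_sup S) <= K%:E * B.
Proof.
have [K K0 wK] := omegaE_scale (ler0n R 2).
exists K => // S B [y0 Sy0] S0 SB.
have L0 : 0 <= ereal_sup S by rewrite (le_trans (S0 _ Sy0))// ereal_sup_ubound.
have B0 : 0 <= B by rewrite (le_trans _ (SB _ Sy0))// omegaE_ge0// S0.
have [Ly|Ly] := eqVneq (ereal_sup S) +oo.
  rewrite Ly; suff -> : B = +oo by rewrite gt0_muley.
  apply/eqP; rewrite -leye_eq leNgt; apply/negP => By.
  have Bf : B \is a fin_num by rewrite ge0_fin_numE.
  case: Hw => _ _ _ winf _.
  have [M [_ MB]] : \forall t \near +oo%R, (fine B + 1 <= w t)%R.
    by move/cvgryPge : winf => /(_ (fine B + 1)%R).
  (* Adding 1 puts the threshold strictly above [M], and the maximum with 0 keeps it in the domain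
     where [w] is monotone. *)
  have : (Num.max M 0 + 1)%:E < ereal_sup S by rewrite Ly ltry.
  move=> /ereal_sup_gt[y Sy My].
  have := SB y Sy; apply/negP; rewrite -ltNge.
  apply: lt_le_trans (omegaE_le _ (ltW My)); last first.
    by rewrite lee_fin addr_ge0// le_max lexx orbT.
  rewrite /= -(fineK Bf) lte_fin (lt_le_trans _ (MB _ _))//.
    by rewrite ltrDl.
  by rewrite (le_lt_trans (_ : M <= Num.max M 0)%R) ?le_max ?lexx// ltrDl.
have Lf : ereal_sup S \is a fin_num by rewrite ge0_fin_numE// ltey.
have [LE|L1] := eqVneq (ereal_sup S) 0.
  by rewrite LE omegaE0 mule_ge0// lee_fin ltW.
have Lpos : (0 < fine (ereal_sup S))%R.
  by rewrite fine_gt0// lt_neqAle eq_sym L1 L0/= ltey.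
have : (fine (ereal_sup S) / 2)%:E < ereal_sup S.
  by rewrite -[ltRHS](fineK Lf) lte_fin ltr_pdivrMr// mulr_natr mulr2n ltrDl.
move=> /ereal_sup_gt[y Sy Ly2].
have -> : ereal_sup S = 2%:R%:E * (fine (ereal_sup S) / 2)%:E.
  by rewrite -[LHS](fineK Lf) -EFinM mulrC divfK.
have L20 : 0 <= (fine (ereal_sup S) / 2)%:E :> \bar R.
  by rewrite lee_fin divr_ge0// ltW.
apply: le_trans (wK _ L20) _; rewrite lee_pmul2l ?lte_fin//.
by apply: le_trans (SB _ Sy); apply: omegaE_le => //; exact: ltW.
Qed.

(** By monotonicity the points t >= 0 with w t < r form an interval, hence a measurable set. *)
Lemma measurable_omegaE d (X : measurableType d) (q : X -> \bar R) :
  measurable_fun setT q -> (forall p, 0 <= q p) ->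
  measurable_fun setT (fun p => omegaE w (q p)).
Proof.
move=> mq q0.
apply: (measurability _ (ErealGenInftyO.measurableE R)) => _ [_ [r ->] <-].
pose I := [set t : R | (0 <= t)%R /\ (w t < r)%R].
have mI : measurable (EFin @` I).
  apply: measurable_image_EFin; apply: is_interval_measurable => s t [s0 sr] [t0 tr].
  move=> u /andP[su ut]; split; first exact: le_trans s0 su.
  case: Hw => _ _ [wle _] _ _.
  by apply: le_lt_trans tr; apply: wle => //; exact: le_trans s0 su.
rewrite setTI (_ : _ @^-1` _ = q @^-1` (EFin @` I)); last first.
  apply/seteqP; split => p /=; rewrite in_itv/=.
    have := q0 p; case: (q p) => [t| |]//=; rewrite !lee_fin => t0 tr.
    by exists t => //; split => //; rewrite -lte_fin.
  by move=> [t [t0 tr] <-] /=; rewrite lte_fin.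
by rewrite -[X in measurable X]setTI; exact: mq.
Qed.

End omega.

(** * Overlap of a set with its small axis translates *)

Section translation_overlap.
Variable R : realType.
Local Open Scope ereal_scope.
Local Notation mu := (@lebesgue_measure R).
Implicit Types n : nat.

Lemma integral_indicT (A : set R) : measurable A ->
  \int[mu]_x (\1_A x)%:E = mu A.
Proof. by move=> mA; rewrite integral_indic// setIT. Qed.

Lemma measurable_preimage_shift (A : set R) (s : R) : measurable A ->
  measurable [set x | A (x + s)%R].
Proof.
move=> mA; rewrite -[X in measurable X]setTI.
have m : measurable_fun setT (fun x : R => (x + s)%R) by exact: measurable_funD.
exact: m.
Qed.

Lemma lebesgue_measure_shift (A : set R) (s : R) : measurable A ->
  mu [set x | A (x + s)%R] = mu A.
Proof.
move=> mA; rewrite -!integral_indicT//; last exact: measurable_preimage_shift.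
have := @ge0_integral_affine R (fun x => (\1_A x)%:E) 1 s ltr01
  (measurable_indicE mA) (indicE_ge0 R A).
rewrite invr1 mul1e => <-; apply: eq_integral => x _.
by rewrite mul1r !indicE.
Qed.

(** Continuity of addition gives the claim near each point of [K]; compactness, in its near-covering
    form, makes it uniform. *)
Lemma open_near_shift_compact (K U : set R) : compact K -> open U -> K `<=` U ->
  \forall s \near (0 : R)%R, forall x, K x -> U (x + s)%R.
Proof.
move=> cK oU KU.
have := (compact_near_coveringP K).1 cK R (nbhs (0 : R)%R)
  (fun s x => U (x + s)%R) _.
apply => x Kx.
have : (x + 0)%R \in U by rewrite inE addr0; exact: KU.
rewrite inE => Ux0.
have := @add_continuous R (x, 0%R) U.
by apply; exact: open_nbhs_nbhs.
Qed.

(** By inner and outer regularity, take a compact [K] in [A] and an open [U] around [K] with U \ K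
    of measure below [e]. Small shifts keep [K] inside [U], so all of [K] except a part of measure
    at most [e] is shifted into [K]. *)
Lemma lebesgue_measure_overlap (A : set R) (s_ : nat -> R) : measurable A ->
  s_ @ \oo --> (0 : R)%R ->
  mu A <= limn_einf (fun k => mu (A `&` [set x | A (x + s_ k)%R])).
Proof.
move=> mA s0; rewrite lebesgue_regularity_inner_sup//.
apply: ge_ereal_sup => _ [K [cK KA] <-].
have mK : measurable K by exact: compact_measurable.
have Kfin : mu K < +oo by exact: compact_finite_measure.
apply/lee_addgt0Pr => e e0.
have [U [oU KU Ue]] := lebesgue_regularity_outer mK Kfin e0.
have mU : measurable U by exact: open_measurable.
rewrite -leeBlDr//; apply: le_limn_einf.
have : \forall k \near \oo, forall x, K x -> U (x + s_ k)%R.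
  exact: (s0 _ (open_near_shift_compact cK oU KU)).
apply: filterS => k KUk; rewrite leeBlDr//.
have mKs := measurable_preimage_shift (s_ k) mK.
have mAs := measurable_preimage_shift (s_ k) mA.
rewrite (measureDI mu mK mKs) addeC leeD//.
  apply: le_measure; rewrite ?inE; try exact: measurableI.
  by move=> x [Kx Ksx]; split; exact: KA.
apply: le_trans (ltW Ue).
(* The points of [K] that the shift moves out of [K] land in U \ K. *)
rewrite -[leRHS](lebesgue_measure_shift (s_ k) (measurableD mU mK)).
apply: le_measure; rewrite ?inE.
- exact: measurableD.
- by apply: measurable_preimage_shift; exact: measurableD.
- by move=> x [Kx nKx]; split; [exact: KUk|].
Qed.

Definition axis n (i : 'I_n) (s : R) : n.-tuple R :=
  [tuple if j == i then s else 0%R | j < n].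

Lemma vadd_axis0 n (x s : R) (t : n.-tuple R) :
  vadd [tuple of x :: t] (axis ord0 s) = [tuple of (x + s)%R :: t].
Proof.
apply: eq_from_tnth => j; rewrite tnth_vadd tnth_mktuple.
by case: (unliftP ord0 j) => [k|] ->; rewrite ?tnthS ?tnth0//= addr0.
Qed.

Lemma vadd_axisS n (i : 'I_n) (x s : R) (t : n.-tuple R) :
  vadd [tuple of x :: t] (axis (lift ord0 i) s) = [tuple of x :: vadd t (axis i s)].
Proof.
apply: eq_from_tnth => j; rewrite tnth_vadd tnth_mktuple.
case: (unliftP ord0 j) => [k|] ->; rewrite ?tnthS ?tnth0//= ?addr0//.
by rewrite tnth_vadd tnth_mktuple (inj_eq lift_inj).
Qed.

Definition overlap n (E : set (n.-tuple R)) (v : n.-tuple R) :=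
  E `&` [set h | E (vadd h v)].

Lemma measurable_overlap n (E : set (n.-tuple R)) v :
  measurable E -> measurable (overlap E v).
Proof.
move=> mE; apply: measurableI => //.
rewrite -[X in measurable X]setTI.
exact: (measurable_vadd (g := cst v)).
Qed.

(** Only a lower bound in the limit is claimed, so Fatou's lemma can integrate the one-dimensional
    estimate over slices of [E]. *)
Lemma intRN_overlap n (E : set (n.-tuple R)) (i : 'I_n) (s_ : nat -> R) :
  measurable E -> s_ @ \oo --> (0 : R)%R ->
  intRN (fun h => (\1_E h)%:E) <=
  limn_einf (fun k => intRN (fun h => (\1_(overlap E (axis i (s_ k))) h)%:E)).
Proof.
elim: n E i => [|n IH] E i mE s0; first by case: i.
have mO k : measurable (overlap E (axis i (s_ k))) by exact: measurable_overlap.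
have mtail (F : set (n.+1.-tuple R)) : measurable F ->
    measurable_fun setT (fun p : R * n.-tuple R => (\1_F [tuple of p.1 :: p.2] : R)%:E).
  by move=> mF; apply: (measurableT_comp (measurable_indicE mF)); exact: measurable_tuple_cons.
(* Shift along the first axis: that coordinate is integrated innermost, so that the estimate on
   lines applies for fixed values of the others, over which Fatou's lemma integrates. *)
case: (unliftP ord0 i) => [j|] ij /=; last first.
  have mslice (F : set (n.+1.-tuple R)) (t : n.-tuple R) : measurable F ->
      measurable [set x | F [tuple of x :: t]].
    move=> mF; rewrite -[X in measurable X]setTI.
    exact: (measurable_cons (g := cst t)).
  have mint (F : set (n.+1.-tuple R)) : measurable F ->
      measurable_fun setT (fun t : n.-tuple R => \int[mu]_x (\1_F [tuple of x :: t] : R)%:E).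
    move=> mF; apply: (@measurable_fun_fubini_tonelli_G _ _ _ _ R mu
      (fun p : R * n.-tuple R => (\1_F [tuple of p.1 :: p.2] : R)%:E)).
      exact: mtail.
    by move=> p; exact: indicE_ge0.
  have swap (F : set (n.+1.-tuple R)) : measurable F ->
      \int[mu]_x intRN (fun t : n.-tuple R => (\1_F [tuple of x :: t] : R)%:E) =
      intRN (fun t => \int[mu]_x (\1_F [tuple of x :: t] : R)%:E).
    move=> mF; apply: (@intRN_swap R n (fun p => (\1_F [tuple of p.1 :: p.2] : R)%:E)).
      exact: mtail.
    by move=> p; exact: indicE_ge0.
  rewrite swap//; under [X in limn_einf X]eq_fun do rewrite swap//.
  apply: le_trans (intRN_fatou _ _); last 2 first.
  - by move=> k; exact: mint.
  - by move=> k t; apply: integral_ge0 => x _; exact: indicE_ge0.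
  apply: le_intRN.
  - exact: mint.
  - by apply: measurable_limn_einf => k; exact: mint.
  - by move=> t; apply: integral_ge0 => x _; exact: indicE_ge0.
  move=> t.
  have slice (F : set (n.+1.-tuple R)) : measurable F ->
      \int[mu]_x (\1_F [tuple of x :: t] : R)%:E = mu [set x | F [tuple of x :: t]].
    by move=> mF; rewrite -integral_indicT//; exact: mslice.
  rewrite slice//; under [X in limn_einf X]eq_fun do rewrite slice//.
  apply: (le_trans (lebesgue_measure_overlap (mslice _ t mE) s0)).
  rewrite le_eqVlt; apply/orP; left; apply/eqP; congr limn_einf.
  apply/funext => k; congr (mu _); apply/seteqP.
  by split => x /=; rewrite /overlap/= ij vadd_axis0.
(* Shift along a later axis: the slices at a fixed first coordinate satisfy the induction
   hypothesis, and Fatou's lemma on the line concludes. *)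
apply: le_trans (fatou _ _ _ _) => //; last 2 first.
- move=> k; apply: (measurable_intRN_tail (measurable_indicE (mO k))).
  exact: indicE_ge0.
- by move=> k x _; apply: intRN_ge0 => t; exact: indicE_ge0.
apply: ge0_le_integral => //.
- by move=> x _; apply: intRN_ge0 => t; exact: indicE_ge0.
- exact: (measurable_intRN_tail (measurable_indicE mE) (indicE_ge0 R E)).
- apply: measurable_limn_einf => k.
  exact: (measurable_intRN_tail (measurable_indicE (mO k)) (indicE_ge0 R _)).
move=> x _.
have mEx : measurable [set t : n.-tuple R | E [tuple of x :: t]].
  rewrite -[X in measurable X]setTI.
  exact: (measurable_cons (f := cst x)).
have IHx := IH [set t : n.-tuple R | E [tuple of x :: t]] j mEx s0.
have -> : (fun k => intRN (fun t : n.-tuple R =>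
    (\1_(overlap E (axis i (s_ k))) [tuple of x :: t] : R)%:E)) =
  (fun k => intRN (fun t => (\1_(overlap [set t : n.-tuple R | E [tuple of x :: t]]
    (axis j (s_ k))) t : R)%:E)).
  apply/funext => k; congr intRN; apply/funext => t; rewrite !indicE.
  suff -> : ([tuple of x :: t] \in overlap E (axis i (s_ k))) =
      (t \in overlap [set t : n.-tuple R | E [tuple of x :: t]] (axis j (s_ k))).
    by [].
  by apply/idP/idP; rewrite !inE /overlap/= ij vadd_axisS.
apply: le_trans IHx; rewrite le_eqVlt; apply/orP; left; apply/eqP.
by congr intRN; apply/funext => t; rewrite !indicE.
Qed.

End translation_overlap.

(** * The mollified functional *)

Section mollified_functional.
Variables (R : realType) (n : nat).
Local Open Scope ereal_scope.

Lemma measurable_rho_eps (rho : n.-tuple R -> R) (eps : R) :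
  measurable_fun setT rho -> measurable_fun setT (rho_eps rho eps).
Proof.
move=> mrho; apply: measurable_funM => //.
by apply: (measurableT_comp mrho); exact: measurable_vscale.
Qed.

(** The sets [E k] exhaust the region where rho > 0; were they all null, Fatou's lemma would make
    the integral of [rho] vanish. Their measure is finite because their indicator is at most r
    rho. *)
Lemma exists_superlevel (rho : n.-tuple R -> R) :
  measurable_fun setT rho -> (forall h, (0 <= rho h)%R) ->
  0 < intRN (fun h => (rho h)%:E) -> intRN (fun h => (rho h)%:E) < +oo ->
  exists (r : R) (E : set (n.-tuple R)), [/\ (0 < r)%R, measurable E,
    forall h, E h -> (1 <= r * rho h)%R /\ (enorm h <= r)%R,
    0 < intRN (fun h => (\1_E h : R)%:E) &
    intRN (fun h => (\1_E h : R)%:E) < +oo].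
Proof.
move=> mrho rho0 Ipos Ifin.
pose r (k : nat) : R := k.+1%:R.
have r0 k : (0 < r k)%R by rewrite /r ltr0n.
(* The condition rho <= r k serves to bound the integral of [rho] over [E k] by r k times the
   measure of [E k]. *)
pose E k := [set h | (1 <= r k * rho h)%R] `&` ([set h | (rho h <= r k)%R] `&`
  [set h : n.-tuple R | (enorm h <= r k)%R]).
have mE k : measurable (E k).
  apply: measurableI; last apply: measurableI.
  - rewrite -[X in measurable X]setTI.
    by apply: (measurable_fun_le _ _) => //; exact: measurable_funM.
  - rewrite -[X in measurable X]setTI.
    exact: measurable_fun_le.
  - rewrite -[X in measurable X]setTI.
    by apply: measurable_fun_le => //; exact: measurable_enorm.
have mrhoE : measurable_fun setT (fun h => (rho h)%:E) by exact/measurable_EFinP.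
have rhoE0 h : 0 <= (rho h)%:E by rewrite lee_fin.
have rE0 k : 0 <= (r k)%:E by rewrite lee_fin ltW.
have near_r (c : R) : \forall k \near \oo, (c <= r k)%R.
  exists (Num.bound `|c|%R) => // k /= ck.
  rewrite (le_trans (ler_norm c))// (le_trans (ltW (archi_boundP (normr_ge0 c))))//.
  by rewrite ler_nat (leq_trans ck).
have Efin k : intRN (fun h => (\1_(E k) h : R)%:E) < +oo.
  apply: (@le_lt_trans _ _ ((r k)%:E * intRN (fun h => (rho h)%:E))); last first.
    by rewrite lte_mul_pinfty// lee_fin ltW.
  rewrite -intRNZl//; apply: le_intRN => //.
  - exact: measurable_indicE.
  - exact: measurable_funeM.
  move=> h; rewrite -EFinM lee_fin indicE.
  have [/set_mem[//]|_] := boolP (h \in E k).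
  by rewrite mulr_ge0// ltW.
suff [k Ek] : exists k, 0 < intRN (fun h => (\1_(E k) h : R)%:E).
  by exists (r k), (E k); split => // h [? []].
apply: contrapT => noE.
have E0 k : intRN (fun h => (\1_(E k) h : R)%:E) = 0.
  apply/eqP; rewrite eq_le intRN_ge0 ?andbT; last by move=> h; exact: indicE_ge0.
  by rewrite leNgt; apply/negP => Ek; apply: noE; exists k.
pose g k h := (rho h)%:E * (\1_(E k) h : R)%:E.
have mg k : measurable_fun setT (g k).
  by apply: emeasurable_funM => //; exact: measurable_indicE.
have g0 k h : 0 <= g k h by rewrite mule_ge0// indicE_ge0.
have gint k : intRN (g k) <= 0.
  rewrite -(mule0 (r k)%:E) -(E0 k) -intRNZl//; last exact: measurable_indicE.
  apply: le_intRN => //; first by apply: measurable_funeM; exact: measurable_indicE.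
  move=> h; rewrite /g -!EFinM lee_fin indicE.
  have [/set_mem[_ [? _]]|_] := boolP (h \in E k); first by rewrite !mulr1.
  by rewrite !mulr0.
have lim h : (rho h)%:E <= limn_einf (g ^~ h).
  have [rh0|rhpos] := leP (rho h) 0%R.
    apply: le_limn_einf; near=> k; apply: le_trans (g0 k h).
    by rewrite lee_fin.
  apply: le_limn_einf; near=> k.
  suff hE : h \in E k by rewrite /g indicE hE mule1.
  rewrite inE; split => /=.
    rewrite -ler_pdivrMr// div1r.
    by near: k; exact: near_r.
  by split; near: k; exact: near_r.
have : intRN (fun h => (rho h)%:E) <= 0.
  apply: (@le_trans _ _ (intRN (fun h => limn_einf (g ^~ h)))).
    by apply: le_intRN => //; exact: measurable_limn_einf.
  apply: (le_trans (intRN_fatou mg g0)).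
  rewrite leNgt; apply/negP => /lt_limn_einf[K _ /(_ K (leqnn K))].
  by rewrite ltNge gint.
by rewrite leNgt Ipos.
Unshelve. all: by end_near. Qed.

End mollified_functional.

(** * Upper bound for the functional, and lower bound through overlaps *)

Section functional_bounds.
Variables (R : realType) (n : nat) (w : R -> R) (rho : n.-tuple R -> R).
Hypothesis Hw : C_inc_plus w.
Hypothesis mrho : measurable_fun setT rho.
Hypothesis rho0 : forall h, (0 <= rho h)%R.
Local Open Scope ereal_scope.

(** Rough subadditivity is iterated; since [B] bounds every term, the constant depends only on [w]
    and on the number of terms. *)
Lemma omegaE_sum (m : nat) : exists2 K : R, (0 < K)%R &
  forall (x : 'I_m -> \bar R) (B : \bar R), (forall j, 0 <= x j) -> 0 <= B ->
    (forall j, omegaE w (x j) <= B) -> omegaE w (\sum_(j < m) x j) <= K%:E * B.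
Proof.
have [A A0 wA] := omegaE_add Hw.
elim: m => [|m [K K0 IH]].
  by exists 1%R => // x B x0 B0 xB; rewrite big_ord0 omegaE0// mul1e.
exists (A * (1 + K))%R => [|x B x0 B0 xB]; first by rewrite mulr_gt0// addr_gt0.
rewrite big_ord_recl; apply: (le_trans (wA _ _ _ _)) => //.
  by apply: sume_ge0 => j _.
rewrite EFinM -muleA lee_pmul2l ?lte_fin//.
rewrite EFinD ge0_muleDl ?lee_fin ?(ltW K0)// mul1e.
by apply: leeD => //; apply: IH.
Qed.

(** The integral under the upper limit in [mod_limsup]. *)
Definition functional (f : n.-tuple R -> R) (eps : R) :=
  intRN (fun h => (rho_eps rho eps h)%:E * omegaE w (diff_quot f h)).

Section one_function.
Variable f : n.-tuple R -> R.
Hypothesis mf : measurable_fun setT f.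

Lemma diff_quotE h : diff_quot f h = modulus f h * ((enorm h)^-1)%:E.
Proof. by []. Qed.

Lemma diff_quot_ge0 h : 0 <= diff_quot f h.
Proof. by rewrite mule_ge0 ?modulus_ge0// lee_fin invr_ge0 enorm_ge0. Qed.

Lemma measurable_diff_quot : measurable_fun setT (diff_quot f).
Proof.
apply: emeasurable_funM; first exact: measurable_modulus.
apply/measurable_EFinP.
(* The inverse is the real power of exponent -1, which is measurable; the two agree at norm 0 as
   well. *)
rewrite (_ : (fun h => (enorm h)^-1%R) = (fun h => (enorm h `^ (-1))%R)).
  exact: (measurableT_comp (measurable_powR (-1)) (@measurable_enorm R n)).
by apply/funext => h; rewrite powR_inv1// enorm_ge0.
Qed.

Lemma measurable_omega_diff_quot : measurable_fun setT (fun h => omegaE w (diff_quot f h)).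
Proof. by apply: measurable_omegaE => //; [exact: measurable_diff_quot|exact: diff_quot_ge0]. Qed.

Lemma omega_diff_quot_ge0 h : 0 <= omegaE w (diff_quot f h).
Proof. by apply: omegaE_ge0 => //; exact: diff_quot_ge0. Qed.

Lemma rho_eps_ge0 eps h : (0 < eps)%R -> (0 <= rho_eps rho eps h)%R.
Proof. by move=> e0; rewrite mulr_ge0// invr_ge0 exprn_ge0// ltW. Qed.

Lemma functional_ge0 eps : (0 < eps)%R -> 0 <= functional f eps.
Proof.
move=> e0; apply: intRN_ge0 => h; rewrite mule_ge0//.
  by rewrite lee_fin rho_eps_ge0.
exact: omega_diff_quot_ge0.
Qed.

(** Monotonicity of omega and the unit mass of the mollifier give the upper estimate with constant
    1. *)
Lemma functional_le (L : \bar R) eps : (0 < eps)%R ->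
  intRN (fun h => (rho_eps rho eps h)%:E) = 1 ->
  0 <= L -> (forall h, diff_quot f h <= L) -> functional f eps <= omegaE w L.
Proof.
move=> e0 I1 L0 fL.
have r0 h : 0 <= (rho_eps rho eps h)%:E by rewrite lee_fin rho_eps_ge0.
have mr : measurable_fun setT (fun h => (rho_eps rho eps h)%:E).
  by apply/measurable_EFinP; exact: measurable_rho_eps.
rewrite -[leRHS]mule1 -I1 -intRNZl//; last exact: omegaE_ge0.
apply: le_intRN.
- apply: emeasurable_funM => //; exact: measurable_omega_diff_quot.
- exact: measurable_funeM.
- by move=> h; rewrite mule_ge0// omega_diff_quot_ge0.
- move=> h; rewrite muleC; apply: lee_wpmul2r => //.
  by apply: omegaE_le => //; exact: diff_quot_ge0.
Qed.

(** The substitution moves the scale from the mollifier to the difference quotient, so that one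
    fixed set where [rho] is bounded below serves for all [eps]. *)
Lemma functional_scale eps : (0 < eps)%R ->
  functional f eps =
  intRN (fun h => (rho h)%:E * omegaE w (diff_quot f (vscale eps h))).
Proof.
move=> e0.
pose G h := (rho h)%:E * omegaE w (diff_quot f (vscale eps h)).
have mG : measurable_fun setT G.
  apply: emeasurable_funM; first exact/measurable_EFinP.
  apply: (measurableT_comp measurable_omega_diff_quot).
  exact: measurable_vscale.
have G0 h : 0 <= G h by rewrite mule_ge0 ?lee_fin// omega_diff_quot_ge0.
pose z : n.-tuple R := [tuple of nseq n 0%R].
have ei0 : (0 < eps^-1)%R by rewrite invr_gt0.
have mGe : measurable_fun setT (fun h => G (vadd (vscale eps^-1 h) z)).
  apply: (measurableT_comp mG).
  by apply: (measurable_vadd (g := cst z)) => //; exact: measurable_vscale.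
transitivity (intRN (fun h => (eps ^- n)%:E * G (vadd (vscale eps^-1 h) z))).
  congr intRN; apply/funext => h.
  by rewrite vadd0 /G vscaleA divff ?gt_eqF// vscale1 muleA -EFinM.
rewrite intRNZl//; last by rewrite lee_fin invr_ge0 exprn_ge0// ltW.
rewrite (intRN_affine z ei0 mG G0) muleA -EFinM exprVn invrK mulVf ?mul1e//.
by rewrite expf_neq0// gt_eqF.
Qed.

Lemma modulus_le_diff_quot (c : R) h : (0 < c)%R -> (enorm h <= c)%R ->
  modulus f h * (c^-1)%:E <= diff_quot f h.
Proof.
move=> c0 hc; rewrite diff_quotE.
(* At h = 0 the inverse of the norm is 0 by convention, but the modulus vanishes as well. *)
have [->|h0] := eqVneq h [tuple of nseq n 0%R]; first by rewrite modulus0// !mul0e.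
apply: lee_wpmul2l; first exact: modulus_ge0.
by rewrite lee_fin lef_pV2// posrE enorm_gt0.
Qed.

End one_function.

(* Integrating the pointwise inequality
   [omega (D (eps v) / (eps r)) <= A (omega (q (eps (h + v))) + omega (q (eps h)))]
   over [h] in [E] with [h + v] in [E], where [D] is the modulus and [q] the
   difference quotient: [v] splits as [(h + v) - h]. *)
Lemma overlap_bound (r : R) (E : set (n.-tuple R)) : (0 < r)%R -> measurable E ->
  (forall h, E h -> (1 <= r * rho h)%R /\ (enorm h <= r)%R) ->
  exists2 K : R, (0 < K)%R & forall f v eps, measurable_fun setT f -> (0 < eps)%R ->
    omegaE w (modulus f (vscale eps v) * ((eps * r)^-1)%:E) *
      intRN (fun h => (\1_(overlap E v) h : R)%:E) <= K%:E * functional f eps.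
Proof.
move=> r0 mE Er; have [A A0 wA] := omegaE_add Hw.
(* [A] comes from rough subadditivity, [r] from 1 <= r rho on [E], and 2 from two integrals that
   shift invariance makes equal. *)
exists (A * (2 * r))%R => [|f v eps mf e0]; first by rewrite !mulr_gt0.
have er0 : (0 < eps * r)%R by rewrite mulr_gt0.
set T := omegaE w _.
have T0 : 0 <= T.
  by apply: omegaE_ge0 => //; rewrite mule_ge0 ?modulus_ge0// lee_fin invr_ge0 ltW.
pose Q h := omegaE w (diff_quot f (vscale eps h)).
have Q0 h : 0 <= Q h by exact: omega_diff_quot_ge0.
have mQ : measurable_fun setT Q.
  by apply: (measurableT_comp (measurable_omega_diff_quot mf)); exact: measurable_vscale.
have mrhoE : measurable_fun setT (fun h => (rho h)%:E) by exact/measurable_EFinP.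
pose EQ h := (\1_E h : R)%:E * Q h.
have EQ0 h : 0 <= EQ h by rewrite mule_ge0// indicE_ge0.
have mEQ : measurable_fun setT EQ.
  by apply: emeasurable_funM => //; exact: measurable_indicE.
have mEQv : measurable_fun setT (fun h => EQ (vadd h v)).
  by apply: (measurableT_comp mEQ); exact: (measurable_vadd (g := cst v)).
have mO := measurable_overlap v mE.
have EQ_F : intRN EQ <= r%:E * functional f eps.
  rewrite functional_scale// -intRNZl//; last 3 first.
  - exact: emeasurable_funM.
  - by move=> h; rewrite mule_ge0 ?lee_fin// Q0.
  - by rewrite lee_fin ltW.
  apply: le_intRN => //; first by apply: measurable_funeM; exact: emeasurable_funM.
  move=> h; rewrite /EQ muleA -EFinM; apply: lee_wpmul2r => //.
  rewrite lee_fin indicE.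
  have [/set_mem/Er[//]|_] := boolP (h \in E).
  by rewrite mulr_ge0// ltW.
have ptw h : T * (\1_(overlap E v) h : R)%:E <= A%:E * (EQ (vadd h v) + EQ h).
  rewrite indicE; have [/set_mem[Eh Ehv]|_] := boolP (h \in overlap E v); last first.
    by rewrite mule0 mule_ge0 ?adde_ge0// lee_fin ltW.
  rewrite mule1 /EQ !indicE mem_set// mem_set// !mul1e.
  apply: le_trans (wA _ _ (diff_quot_ge0 f _) (diff_quot_ge0 f _)).
  have enorm_le k : E k -> (enorm (vscale eps k) <= eps * r)%R.
    by move=> /Er[_ kr]; rewrite enorm_vscale gtr0_norm// ler_pM2l.
  apply: omegaE_le => //; first by rewrite mule_ge0 ?modulus_ge0// lee_fin invr_ge0 ltW.
  apply: le_trans (leeD (modulus_le_diff_quot _ er0 (enorm_le _ Ehv))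
                        (modulus_le_diff_quot _ er0 (enorm_le _ Eh))).
  rewrite -ge0_muleDl ?modulus_ge0//; apply: lee_wpmul2r.
    by rewrite lee_fin invr_ge0 ltW.
  (* D is even and eps (h + v) - eps h = eps v. *)
  rewrite -(modulus_opp f (vscale eps h)).
  rewrite [leLHS](_ : _ = modulus f (vadd (vscale eps (vadd h v))
      (vscale (-1) (vscale eps h)))); first exact: modulus_add.
  by congr modulus; rewrite vscaleDr (vaddC (vscale eps h)) -vaddA vaddNr vadd0.
rewrite -intRNZl//; last exact: measurable_indicE.
apply: (@le_trans _ _ (intRN (fun h => A%:E * (EQ (vadd h v) + EQ h)))).
  apply: le_intRN => //.
  - by apply: measurable_funeM; exact: measurable_indicE.
  - by apply: measurable_funeM; exact: emeasurable_funD.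
  - by move=> h; rewrite mule_ge0// indicE_ge0.
rewrite intRNZl//; last 3 first.
- exact: emeasurable_funD.
- by move=> h; rewrite adde_ge0.
- by rewrite lee_fin ltW.
rewrite intRND// (intRN_shift v mEQ EQ0) EFinM -muleA lee_pmul2l ?lte_fin//.
rewrite EFinM -muleA (_ : 2%:E = 1 + 1)// ge0_muleDl// mul1e.
exact: leeD.
Qed.

End functional_bounds.

(** * From small axis shifts to arbitrary vectors *)

Section lower_bound.
Variables (R : realType) (n : nat) (w : R -> R).
Hypothesis Hw : C_inc_plus w.
Local Open Scope ereal_scope.

Lemma vscale_axis (i : 'I_n) (a s : R) : vscale a (axis i s) = axis i (a * s)%R.
Proof.
apply: eq_from_tnth => j; rewrite tnth_vscale !tnth_mktuple.
by case: ifP; rewrite ?mulr0.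
Qed.

Lemma sum_axes (h : n.-tuple R) :
  [tuple (\sum_(j < n) tnth (axis j (tnth h j)) i)%R | i < n] = h.
Proof.
apply: eq_from_tnth => i; rewrite tnth_mktuple (bigD1 i)//= tnth_mktuple eqxx.
rewrite big1 ?addr0// => j ji.
by rewrite tnth_mktuple eq_sym (negbTE ji).
Qed.

Lemma modulus_axis (f : n.-tuple R -> R) (i : 'I_n) (a : R) :
  modulus f (axis i a) = modulus f (axis i `|a|%R).
Proof.
have [a0|a0] := leP 0%R a; first by rewrite ger0_norm.
by rewrite ltr0_norm// -[RHS]modulus_opp vscale_axis mulN1r opprK.
Qed.

(** The vector h / k is the sum of its axis components, the j-th being plus or minus eps s e_j with
    eps = |h_j| / (k s) < delta. [K1] absorbs the factor r / s and [K2] the sum over the axes. *)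
Lemma diff_quot_axes_bound (r s : R) : (0 < r)%R -> (0 < s)%R ->
  exists2 K : R, (0 < K)%R & forall f (delta : R) (B : \bar R), measurable_fun setT f ->
    (0 < delta)%R -> 0 <= B ->
    (forall eps (j : 'I_n), (0 < eps < delta)%R ->
      omegaE w (modulus f (vscale eps (axis j s)) * ((eps * r)^-1)%:E) <= B) ->
    forall h, h != [tuple of nseq n 0%R] -> omegaE w (diff_quot f h) <= K%:E * B.
Proof.
move=> r0 s0.
have rs0 : (0 <= r / s)%R by rewrite divr_ge0// ltW.
have [K1 K10 wK1] := omegaE_scale Hw rs0.
have [K2 K20 wK2] := omegaE_sum Hw n.
exists (K1 * K2)%R => [|f delta B mf d0 B0 fB h h0]; first exact: mulr_gt0.
have H0 : (0 < enorm h)%R by rewrite enorm_gt0.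
have sd0 : (0 < s * delta)%R by rewrite mulr_gt0.
(* This choice gives |h| / (k s) < delta. *)
pose k : R := (Num.bound (enorm h / (s * delta)))%:R.
have Hk : (enorm h / (s * delta) < k)%R by apply: archi_boundP; rewrite divr_ge0// ltW.
have k0 : (0 < k)%R by apply: le_lt_trans Hk; rewrite divr_ge0// ltW.
(* Chosen so that (r / s) c = k / |h|; for each nonzero component, |h_j| <= |h| gives c <= 1 / (eps
   r). *)
pose c : R := (k * s / (r * enorm h))%R.
have c0 : (0 <= c)%R by rewrite divr_ge0// mulr_ge0// ltW.
pose x (j : 'I_n) := modulus f (axis j (tnth h j / k)%R) * c%:E.
have x0 j : 0 <= x j by rewrite mule_ge0 ?modulus_ge0// lee_fin.
have xB j : omegaE w (x j) <= B.
  rewrite /x modulus_axis normrM [X in (_ * X)%R]gtr0_norm ?invr_gt0//.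
  (* A zero component would give eps = 0, outside the range of the hypothesis on [B]. *)
  have [a0|a0] := eqVneq (tnth h j) 0%R.
    rewrite a0 normr0 mul0r (_ : axis j 0 = [tuple of nseq n 0%R]).
      by rewrite modulus0// mul0e omegaE0.
    by apply: eq_from_tnth => i; rewrite tnth_mktuple tnth_nseq if_same.
  have na0 : (0 < `|tnth h j|)%R by rewrite normr_gt0.
  pose eps := (`|tnth h j| / (k * s))%R.
  have ks0 : (0 < k * s)%R by rewrite mulr_gt0.
  have eps0 : (0 < eps)%R by rewrite divr_gt0.
  have epsd : (0 < eps < delta)%R.
    rewrite eps0/= ltr_pdivrMr// (le_lt_trans (le_tnth_enorm h j))//.
    by rewrite mulrC -mulrA -ltr_pdivrMr.
  have -> : axis j (`|tnth h j| / k)%R = vscale eps (axis j s).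
    by rewrite vscale_axis /eps invfM mulrA divfK// gt_eqF.
  apply: le_trans (fB _ j epsd); apply: omegaE_le => //.
    by rewrite mule_ge0 ?modulus_ge0// lee_fin.
  apply: lee_wpmul2l; first exact: modulus_ge0.
  rewrite lee_fin -[leLHS]invrK lef_pV2 ?posrE ?mulr_gt0// ?invr_gt0 ?divr_gt0 ?mulr_gt0//.
  rewrite /eps /c invf_div mulrAC ler_pM2r ?invr_gt0// mulrC ler_pM2l//.
  exact: le_tnth_enorm.
have qx : diff_quot f h <= (r / s)%:E * \sum_(j < n) x j.
  rewrite diff_quotE /x -ge0_sume_distrl; last by move=> j _; exact: modulus_ge0.
  rewrite muleCA -EFinM.
  have -> : (r / s * c)%R = (k * (enorm h)^-1)%R.
    by rewrite /c; field; rewrite !gt_eqF.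
  rewrite EFinM muleA; apply: lee_wpmul2r; first by rewrite lee_fin invr_ge0 ltW.
  rewrite -[X in modulus f X](vscale1 h) -(divff (lt0r_neq0 k0)) -vscaleA.
  apply: (le_trans (modulus_natmul f (Num.bound (enorm h / (s * delta))) _)).
  rewrite [leRHS]muleC; apply: lee_wpmul2l; first by rewrite lee_fin.
  rewrite -[X in modulus f X]sum_axes.
  apply: (le_trans (modulus_sum f _)).
  by apply: lee_sum => j _; rewrite tnth_vscale mulrC.
apply: (le_trans (omegaE_le Hw (diff_quot_ge0 f h) qx)).
apply: (le_trans (wK1 _ _)); first by apply: sume_ge0 => j _.
by rewrite EFinM -muleA lee_pmul2l ?lte_fin// wK2.
Qed.

End lower_bound.

(** * A common axis shift, the two-sided estimate and the equivalence *)

Lemma nseq1_neq0 (R : realType) (n : nat) : (0 < n)%N ->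
  [tuple of nseq n (1 : R)] != [tuple of nseq n 0].
Proof.
move=> n0; apply/eqP => /(congr1 (fun t => tnth t (Ordinal n0))).
by rewrite !tnth_nseq => /eqP; rewrite oner_eq0.
Qed.

(** In positive dimension a nonzero vector exists, so the supremum is over a nonempty set of
    nonnegative values. *)
Lemma lip_seminorm_ge0 (R : realType) (n : nat) (f : n.-tuple R -> R) :
  (0 < n)%N -> (0 <= lip_seminorm f)%E.
Proof.
move=> n0; apply: (@le_trans _ _ (diff_quot f [tuple of nseq n 1])).
  exact: diff_quot_ge0.
by apply: ereal_sup_ubound; exists [tuple of nseq n 1] => //=; exact: nseq1_neq0.
Qed.

(** Along the shifts 1 / (k + 1) each axis eventually satisfies the strict bound, and finitely many
    axes admit a common index. *)
Lemma exists_common_overlap (R : realType) (n : nat) (E : set (n.-tuple R)) (b : \bar R) :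
  measurable E -> (b < intRN (fun h => (\1_E h : R)%:E))%E ->
  exists2 s : R, 0 < s &
    forall i : 'I_n, (b < intRN (fun h => (\1_(overlap E (axis i s)) h : R)%:E))%E.
Proof.
move=> mE bE.
have [K _ HK] : \forall k \near \oo, forall i : 'I_n,
    (b < intRN (fun h => (\1_(overlap E (axis i (harmonic k))) h : R)%:E))%E.
  apply: filter_forall => i; apply: lt_limn_einf.
  apply: (lt_le_trans bE); apply: intRN_overlap => //.
  exact: cvg_harmonic.
exists (harmonic K); first by rewrite /harmonic invr_gt0 ltr0n.
by apply: HK => /=.
Qed.

Theorem theorem2p5 (R : realType) (N : nat) (HN : (1 <= N)%N)
  (w : R -> R) (Hw : C_inc_plus w)
  (rho : N.-tuple R -> R) (Hrho1 : in_L1 rho) (Hrad : radial rho)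
  (Hmoll : mollifier_family (rho_eps rho)) :
  (forall f : N.-tuple R -> R, in_Linf f ->
     (in_C01 f <-> (mod_limsup w rho f < +oo)%E)) /\
  exists c C : R, [/\ 0 < c, c <= C &
    forall f : N.-tuple R -> R, in_Linf f ->
      ((c%:E * omegaE w (lip_seminorm f) <= mod_limsup w rho f)%E /\
       (mod_limsup w rho f <= C%:E * omegaE w (lip_seminorm f))%E)].
Proof.
have mrho := Hrho1.1; have [rhoe0 rhoe1 _] := Hmoll.
(* At eps = 1 the mollifier is [rho] itself, which is therefore nonnegative with unit mass. *)
have rho1E : rho_eps rho 1 = rho.
  by apply/funext => h; rewrite /rho_eps expr1n invr1 mul1r vscale1.
have rho0 h : 0 <= rho h by rewrite -rho1E; exact: rhoe0.
have Irho : intRN (fun h => (rho h)%:E) = 1%E.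
  by have := rhoe1 1 ltr01; rewrite rho1E.
(* The two-sided estimate implies the equivalence: on nonnegative arguments [omegaE w] is infinite
   exactly at +oo, and c > 0. *)
suff [c [C [c0 cC bounds]]] : exists c C : R, [/\ 0 < c, c <= C &
    forall f : N.-tuple R -> R, in_Linf f ->
      ((c%:E * omegaE w (lip_seminorm f) <= mod_limsup w rho f)%E /\
       (mod_limsup w rho f <= C%:E * omegaE w (lip_seminorm f))%E)].
  split; last by exists c, C.
  move=> f fLinf; have [lo up] := bounds f fLinf; split.
    move=> [_ Lf]; apply: (le_lt_trans up); have := lip_seminorm_ge0 f HN.
    by case: (lip_seminorm f) Lf => [L| |]//= _ _; rewrite -EFinM ltry.
  move=> supf; split => //; rewrite ltey; apply/eqP => Lf.
  by move: lo; rewrite Lf /= gt0_muley ?lte_fin// leNgt supf.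
have Ipos : (0 < intRN (fun h => (rho h)%:E))%E by rewrite Irho.
have Ifin : (intRN (fun h => (rho h)%:E) < +oo)%E by rewrite Irho ltry.
have [r [E [r0 mE Er Epos Efin]]] := exists_superlevel mrho rho0 Ipos Ifin.
pose m := fine (intRN (fun h => (\1_E h : R)%:E)).
have Em : intRN (fun h => (\1_E h : R)%:E) = m%:E.
  by rewrite fineK// ge0_fin_numE// ltW.
have m0 : 0 < m by rewrite -lte_fin -Em.
have [s s0 Os] : exists2 s : R, 0 < s & forall i : 'I_N,
    ((m / 2)%:E < intRN (fun h => (\1_(overlap E (axis i s)) h : R)%:E))%E.
  apply: exists_common_overlap => //.
  by rewrite Em lte_fin ltr_pdivrMr// mulr_natr mulr2n ltrDl.
have [K1 K10 HK1] := overlap_bound Hw mrho rho0 r0 mE Er.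
have [K2 K20 HK2] := diff_quot_axes_bound N Hw r0 s0.
have [K3 K30 HK3] := omegaE_sup Hw.
(* From left to right: passage to the supremum, reduction to the axes, the overlap mass m / 2, and
   [overlap_bound]. *)
pose K := K3 * (K2 * (2 / m * K1)).
have m20 : 0 < 2 / m by rewrite divr_gt0.
have K0 : 0 < K by do 3 apply: mulr_gt0 => //.
have Ki0 : 0 < K^-1 by rewrite invr_gt0.
(* The minimum secures c <= C = 1. *)
exists (Num.min K^-1 1), 1; split.
- by rewrite lt_min Ki0 ltr01.
- by rewrite ge_min lexx orbT.
move=> f [mf _]; have L0 := lip_seminorm_ge0 f HN.
have dq0 h : (diff_quot f h <= lip_seminorm f)%E.
  have [->|h0] := eqVneq h [tuple of nseq N 0].
    by rewrite diff_quotE modulus0// mul0e.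
  by apply: ereal_sup_ubound; exists h.
split; last first.
  (* The upper limit is an infimum of suprema over neighbourhoods; the one formed by all eps > 0
     already gives the bound. *)
  rewrite mul1e; apply: (@le_trans _ _ (ereal_sup (functional w rho f @` [set e : R | 0 < e]))).
    by apply: ereal_inf_lbound; exists [set e : R | 0 < e] => //; exact: nbhs_right_gt.
  apply: ge_ereal_sup => _ [e /= e0 <-].
  by apply: functional_le => //; exact: rhoe1.
apply: (@le_trans _ _ (K^-1%:E * omegaE w (lip_seminorm f))%E).
  apply: lee_wpmul2r; first exact: omegaE_ge0.
  by rewrite lee_fin ge_min lexx.
(* Conversely every neighbourhood [V] must be treated; it contains all eps with 0 < eps < delta for
   some [delta], and this is the [delta] of the axis reduction. *)
apply: le_ereal_inf_tmp => _ [V V0 <-].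
have [delta /= d0 Vd] : \forall e \near 0^'+, V e by [].
set S := ereal_sup _.
have FS eps : 0 < eps < delta -> (functional w rho f eps <= S)%E.
  move=> /andP[e0 ed]; apply: ereal_sup_ubound; exists eps => //.
  by apply: Vd => //=; rewrite sub0r normrN gtr0_norm.
have S0 : (0 <= S)%E.
  apply: (@le_trans _ _ (functional w rho f (delta / 2))).
    by apply: functional_ge0 => //; rewrite divr_gt0.
  by apply: FS; rewrite divr_gt0//= ltr_pdivrMr// mulr_natr mulr2n ltrDl.
have KS : (omegaE w (lip_seminorm f) <= K%:E * S)%E.
  rewrite /K EFinM -muleA; apply: HK3.
  - by eexists; exists [tuple of nseq N 1] => //=; exact: nseq1_neq0.
  - by move=> _ [h _ <-]; exact: diff_quot_ge0.
  move=> _ [h /= h0 <-]; rewrite EFinM -muleA; apply: (HK2 f delta _ mf d0 _ _ h h0).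
    by rewrite mule_ge0// lee_fin mulr_ge0// ltW.
  move=> eps j /[dup] /andP[e0 _] /FS FSe.
  set T := omegaE w _.
  have T0 : (0 <= T)%E.
    by apply: omegaE_ge0 => //; rewrite mule_ge0 ?modulus_ge0// lee_fin invr_ge0 mulr_ge0// ltW.
  (* The factor m / 2 is inserted in order to be replaced by the larger measure of the overlap. *)
  have TE : T = ((2 / m)%:E * (T * (m / 2)%:E))%E.
    by rewrite muleCA -EFinM mulrA divfK ?gt_eqF// divff// mule1.
  rewrite TE (EFinM _ K1) -[leRHS]muleA; apply: lee_wpmul2l; first by rewrite lee_fin ltW.
  apply: (@le_trans _ _ (K1%:E * functional w rho f eps)%E); last first.
    by apply: lee_wpmul2l => //; rewrite lee_fin ltW.
  by apply: le_trans (HK1 f (axis j s) eps mf e0); apply: lee_wpmul2l => //; exact: ltW.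
rewrite -[leRHS]mul1e -(mulVf (lt0r_neq0 K0)) EFinM -muleA.
by apply: lee_wpmul2l => //; rewrite lee_fin ltW.
Qed.
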